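(* Let $G=C^m_n$ with $2(m+1)\leq n$, and let $\mathcal R=\{G_i:i\in [n]\}$ be a family of graphs. Then $$\gamma_{gr}(G\hookleftarrow \mathcal R)= \max_{I \in \mathcal I_2} \left\{\sum_{i\in I} \gamma_{gr} (G_i)- |I|(m+1)\right\} + n.$$ Moreover, given a Grundy dominating sequence $S_i$ of $G_i$ for all $i\in [n]$, and $I^*\in \mathcal I_2$ such that $$\sum_{i\in I^*} \gamma_{gr} (G_i)- |I^*|(m+1)=\max_{I \in \mathcal I_2} \left\{\sum_{i\in I} \gamma_{gr} (G_i)- |I|(m+1)\right\},$$ the sequence $S$ obtained from $S_C(I^* )$ by replacing each $i\in I^*$ by the sequence $S_i$ is a Grundy dominating sequence of $G\hookleftarrow \mathcal R$.
   Context: $C_n^m$ is the $m$-th power of the cycle $C_n$, with vertex set $[n]=\{1,\dots,n\}$ (addition modulo $n$), where $i,j$ are adjacent iff their distance in $C_n$ is at most $m$. Given a graph $G$ and a family $\mathcal R=\{G_v: v\in V(G)\}$, $G\hookleftarrow \mathcal R$ (the $X$-join product) is the graph obtained by replacing each vertex $v$ of $G$ by $G_v$ (every vertex of $G_v$ is adjacent to every vertex of $G_u$ whenever $uv\in E(G)$). For a sequence $S=(v_1,\dots,v_k)$ of distinct vertices, $PN_S(v_i)=N[v_i]\setminus\bigcup_{j<i}N[v_j]$; $S$ is a legal dominating sequence if its vertex set is dominating and every $PN_S(v_i)\neq\emptyset$. A Grundy dominating sequence is a legal dominating sequence of maximum length, and $\gamma_{gr}(G)$ is that length. $\mathcal I_2$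 denotes the family of independent sets of $C_n^m$ with at least two vertices. For $1\le i\le j\le n$, $S(i,j)=(i,i+1,\dots,j)$ and $S^{-1}$ denotes a sequence reversed; $\oplus$ is concatenation. For $I=\{i^1<i^2<\dots<i^p\}\in\mathcal I_2$, let $S_j=S(i^j,i^{j+1}-(m+1))$ for $j\in[p-1]$, let $S_p$ be the reverse of the sequence $i^p+(m+1),\dots,i^1-1$ (indices mod $n$) if $i^p+(m+1)\neq i^1$ and the empty sequence otherwise, and $S_C(I)=S_1\oplus\cdots\oplus S_{p-1}\oplus S_p\oplus(i^p)$; this is a legal dominating sequence of $C_n^m$ of length $n-|I|m$. *)

(* Defs.v *)
From HB Require Import structures.
From mathcomp Require Import all_boot all_order all_algebra.
Set Implicit Arguments. Unset Strict Implicit. Unset Printing Implicit Defensive.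

Definition simple_graph (T : finType) (e : rel T) : Prop :=
  symmetric e /\ irreflexive e.

Section Grundy.
Variables (T : finType) (e : rel T).

Definition cnbh (v : T) : {set T} := [set u | (u == v) || e v u].

Definition priv_nbh (s : seq T) (i : nat) : {set T} :=
  if drop i s is v :: _ then cnbh v :\: \bigcup_(u <- take i s) cnbh u
  else set0.

Definition dominating_seq (s : seq T) : bool :=
  \bigcup_(u <- s) cnbh u == [set: T].

Definition legal_dom_seq (s : seq T) : bool :=
  [&& uniq s, all (fun i => priv_nbh s i != set0) (iota 0 (size s))
    & dominating_seq s].

(* Grundy domination number: maximum length of a legal dominating sequence
   (such sequences are duplicate-free, so their length is at most #|T|). *)
Definition gamma_gr : nat :=
  \max_(k < #|T|.+1 | [exists t : k.-tuple T, legal_dom_seq t]) k.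

Definition grundy_dom_seq (s : seq T) : bool :=
  legal_dom_seq s && (size s == gamma_gr).

End Grundy.

(* m-th power of the cycle C_n, vertices 'I_n = {0,...,n-1} (0-based version
   of [n]); i,j adjacent iff i <> j and their cyclic distance is <= m. *)
Definition cdist (n : nat) (i j : nat) : nat :=
  let d := (i - j) + (j - i) in minn d (n - d).

Definition cpow_adj (n m : nat) : rel 'I_n :=
  fun i j => (i != j) && (cdist n i j <= m).

Definition I2 (n m : nat) (I : {set 'I_n}) : bool :=
  [forall i in I, forall j in I, ~~ @cpow_adj n m i j] && (1 < #|I|).

Definition xjoin (V : finType) (eG : rel V) (T : V -> finType)
    (E : forall v, rel (T v)) : rel {v : V & T v} :=
  fun x y => if tag x == tag y then E (tag x) (tagged x) (tagged_as x y)
             else eG (tag x) (tag y).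

Definition SC (n m : nat) (I : {set 'I_n}) : seq nat :=
  let s := sort leq [seq val i | i in I] in
  let p := size s in
  let fst := head 0 s in
  let lst := last 0 s in
  let Sj j := iota (nth 0 s j) (nth 0 s j.+1 - m - nth 0 s j) in
  let Sp := rev [seq (lst + k) %% n | k <- iota m.+1 (fst + n - lst - m.+1)] in
  flatten [seq Sj j | j <- iota 0 p.-1] ++ Sp ++ [:: lst].

Definition replace_seq (n : nat) (T : 'I_n -> finType) (I : {set 'I_n})
    (S : forall i, seq (T i)) (c : forall i, T i) (s : seq nat)
    : seq {i : 'I_n & T i} :=
  flatten [seq (if insub k is Some i then
                 (if i \in I then [seq Tagged T x | x <- S i]
                  else [:: Tagged T (c i)])
               else [::]) | k <- s].

(* Main.v *)
(** Lower bound: in S_C(I), the first vertex of each block, a member of I, is not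
    dominated by anything earlier, so it may be replaced by a sequence of its own
    factor; every other vertex of S_C(I) still footprints a whole factor.

    Upper bound: read a legal sequence of the join from left to right. Let D be the
    set of vertices of the cycle dominated by the tags read so far, and J the set of
    tags v that were outside D when first read. A step whose footprint has its tag
    outside D enlarges D; every other step footprints the factor of some w in J none
    of whose neighbours has been read, and it extends a legal sequence of that
    factor. Adding N[w] to D never increases the number of arcs of D when w is in D,
    and when w is outside D it increases |D| - m * arcs D by at least m + 1. Hence
    the number of steps plus (m + 1)|J| is at most n + sum_(w in J) gamma_gr (G_w).
    When J is a single vertex, one more vertex at distance m + 1 is added to it. *)
Require Import Defs.
From HB Require Import structures.
From mathcomp Require Import all_boot all_order all_algebra.
From mathcomp Require Import zify.
Set Implicit Arguments. Unset Strict Implicit. Unset Printing Implicit Defensive.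

(** * Legal sequences and the Grundy number of a single graph *)

Section LegalSequences.
Variables (T : finType) (e : rel T).
Implicit Types (s : seq T) (x y u : T).

(** Legality is phrased over splittings instead of positions, and without domination, so that it
    passes to prefixes and suits induction on [rcons]. *)
Definition legal_seq s : Prop := forall s1 x s2, s = s1 ++ x :: s2 ->
  exists2 y, y \in cnbh e x & forall u, u \in s1 -> y \notin cnbh e u.

Lemma bigcup_seqP (F : T -> {set T}) s y :
  reflect (exists2 u, u \in s & y \in F u) (y \in \bigcup_(u <- s) F u).
Proof.
elim: s => [|x s IHs]; first by rewrite big_nil inE; constructor=> -[].
rewrite big_cons inE; apply: (iffP orP) => [[yx|/IHs[u us yu]]|[u]].
- by exists x => //; rewrite mem_head.
- by exists u => //; rewrite inE us orbT.
rewrite inE => /predU1P[-> ?|us yu]; first by left.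
by right; apply/IHs; exists u.
Qed.

Lemma mem_cnbh x : x \in cnbh e x.
Proof. by rewrite inE eqxx. Qed.

Lemma priv_nbh_cat s1 x s2 :
  priv_nbh e (s1 ++ x :: s2) (size s1) =
    cnbh e x :\: \bigcup_(u <- s1) cnbh e u.
Proof. by rewrite /priv_nbh drop_size_cat // take_size_cat. Qed.

Lemma legal_seqP s :
  reflect (legal_seq s) (all (fun i => priv_nbh e s i != set0) (iota 0 (size s))).
Proof.
apply: (iffP allP) => [priv_s s1 x s2 def_s | leg_s i].
  have lt_s1: size s1 \in iota 0 (size s) by rewrite mem_iota def_s size_cat /=; lia.
  have /set0Pn[y] := priv_s _ lt_s1.
  rewrite def_s priv_nbh_cat inE => /andP[/bigcup_seqP ndom yx].
  by exists y => // u us1; apply/negP=> yu; case: ndom; exists u.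
rewrite mem_iota add0n /= => lt_i.
case def_t: (drop i s) => [|x t]; first by have := size_drop i s; rewrite def_t /=; lia.
have def_s: s = take i s ++ x :: t by rewrite -def_t cat_take_drop.
have [y yx ndom] := leg_s _ _ _ def_s; apply/set0Pn; exists y.
rewrite /priv_nbh def_t inE yx andbT; apply/bigcup_seqP=> -[u /ndom].
by move/negP.
Qed.

Lemma legal_seq_uniq s : legal_seq s -> uniq s.
Proof.
elim/last_ind: s => // s x IHs leg_s; rewrite rcons_uniq; apply/andP; split.
  have [y yx ndom] := leg_s s x [::] (esym (cats1 s x)).
  by apply/negP=> /ndom; rewrite yx.
apply: IHs => s1 z s2 def_s; apply: (leg_s s1 z (rcons s2 x)).
by rewrite def_s rcons_cat rcons_cons.
Qed.

Lemma legal_seq_rcons s x :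
  legal_seq (rcons s x) <->
  legal_seq s /\ (exists2 y, y \in cnbh e x & forall u, u \in s -> y \notin cnbh e u).
Proof.
split=> [leg_s | [leg_s priv_x] s1 z s2].
  split; last by apply: (leg_s s x [::]); rewrite cats1.
  move=> s1 z s2 def_s; apply: (leg_s s1 z (rcons s2 x)).
  by rewrite def_s rcons_cat rcons_cons.
case/lastP: s2 => [|s2 z']; first by rewrite cats1 => /rcons_inj[<- <-].
rewrite -rcons_cons -rcons_cat => /rcons_inj[def_s _].
exact: leg_s def_s.
Qed.

Lemma legal_dom_seqP s :
  reflect (legal_seq s /\ forall y, exists2 u, u \in s & y \in cnbh e u)
          (legal_dom_seq e s).
Proof.
apply: (iffP and3P) => [[_ /legal_seqP leg_s /eqP dom_s] | [leg_s dom_s]].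
  by split=> // y; apply/bigcup_seqP; rewrite dom_s inE.
split; [exact: legal_seq_uniq | exact/legal_seqP |].
by apply/eqP/setP=> y; rewrite inE; apply/bigcup_seqP.
Qed.

(** An undominated vertex can always be appended, since it footprints itself. Legal sequences are
    duplicate-free, so this stops within [#|T|] steps. *)
Lemma legal_seq_extend s :
  legal_seq s -> exists2 s', legal_dom_seq e s' & size s <= size s'.
Proof.
have [k] := ubnP (#|T| - size s); elim: k s => // k IHk s lt_k leg_s.
have [dom_s | /forallPn[y ndom]] :=
  boolP [forall y, y \in \bigcup_(u <- s) cnbh e u].
  exists s => //; apply/legal_dom_seqP; split=> // y.
  by apply/bigcup_seqP; apply: (forallP dom_s).
have leg_sy: legal_seq (rcons s y).
  apply/legal_seq_rcons; split=> //; exists y => [|u us]; first exact: mem_cnbh.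
  by apply: contra ndom => yu; apply/bigcup_seqP; exists u.
have le_sy: size (rcons s y) <= #|T|.
  by rewrite -(card_uniqP (legal_seq_uniq leg_sy)) max_card.
case: (IHk (rcons s y)) => [|//|s' leg_s' le_s']; rewrite size_rcons in le_sy *.
  lia.
by exists s' => //; rewrite size_rcons in le_s'; apply: ltnW.
Qed.

Lemma legal_dom_seq_gamma s : legal_dom_seq e s -> size s <= gamma_gr e.
Proof.
move=> dom_s; have /and3P[uniq_s _ _] := dom_s.
have lt_s: size s < #|T|.+1 by rewrite ltnS -(card_uniqP uniq_s) max_card.
apply: (@leq_bigmax_cond _ _ (fun k : 'I__ => nat_of_ord k) (Ordinal lt_s)).
by apply/existsP; exists (in_tuple s).
Qed.

Lemma legal_seq_gamma s : legal_seq s -> size s <= gamma_gr e.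
Proof.
by case/legal_seq_extend=> s' /legal_dom_seq_gamma le_s' /leq_trans->.
Qed.

(** The maximum in [gamma_gr] would default to 0 over an empty range; extending the empty sequence
    shows that the range is inhabited. *)
Lemma gamma_gr_attained : exists s, grundy_dom_seq e s.
Proof.
pose P (k : 'I_#|T|.+1) := [exists t : k.-tuple T, legal_dom_seq e t].
have [s dom_s _]: exists2 s, legal_dom_seq e s & size (@nil T) <= size s.
  by apply: legal_seq_extend => -[].
have /and3P[uniq_s _ _] := dom_s.
have lt_s: size s < #|T|.+1 by rewrite ltnS -(card_uniqP uniq_s) max_card.
have P_s: P (Ordinal lt_s) by apply/existsP; exists (in_tuple s).
have [|k /existsP[t dom_t] def_k] := @eq_bigmax_cond _ P (fun k => nat_of_ord k).
  by apply/card_gt0P; exists (Ordinal lt_s).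
by exists t; rewrite /grundy_dom_seq dom_t size_tuple /gamma_gr def_k eqxx.
Qed.

Lemma gamma_gr_gt0 : 0 < #|T| -> 0 < gamma_gr e.
Proof.
case/card_gt0P=> x _; apply: (@legal_seq_gamma [:: x]).
by move=> [|z [|]] //= y s2 [<- _]; exists x; first exact: mem_cnbh.
Qed.

End LegalSequences.

(** * Filling an arc of [2m+1] positions: effect on size and descents *)

Section Arcs.
Variables (m : nat).
Implicit Types d : nat -> bool.

Lemma sum_nat_bool_gt0 d i j :
  (0 < \sum_(i <= k < j) d k) -> exists2 k, i <= k < j & d k.
Proof.
move=> pos; have /hasP[k] : has d (index_iota i j).
  rewrite -[has _ _]negbK -all_predC; apply/negP=> /allP nd.
  by move: pos; rewrite big_seq big1 // => k /nd /= /negbTE->.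
by rewrite mem_index_iota => ? ?; exists k.
Qed.

Lemma descent_gt0 d i j :
  i <= j -> d i -> ~~ d j -> 0 < \sum_(i <= k < j) (d k && ~~ d k.+1).
Proof.
move=> /subnKC <-; elim: (j - i) => [|l IHl]; first by rewrite addn0 => ->.
move=> di; rewrite addnS => ndj; rewrite big_nat_recr ?leq_addr //=.
have [dl | ndl] := boolP (d (i + l)); first by rewrite ndj addn1.
by rewrite addn0 IHl.
Qed.

Lemma descent_gt0_sub d i j i' j' : i <= i' -> j' <= j -> i' <= j' ->
  d i' -> ~~ d j' -> 0 < \sum_(i <= k < j) (d k && ~~ d k.+1).
Proof.
move=> ii jj ij di dj; have := descent_gt0 ij di dj.
rewrite (@big_cat_nat _ _ _ i' i j) /=; try lia.
rewrite (@big_cat_nat _ _ _ j' i' j) /=; lia.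
Qed.

Lemma sum_nat_bool_le d i j : \sum_(i <= k < j) d k <= j - i.
Proof.
rewrite -[leqRHS]muln1 -sum_nat_const_nat; apply: leq_sum => k _.
exact: leq_b1.
Qed.

(* Positions are counted from just before the arc, so the arc is 1 .. 2m+1 and its centre is m+1. *)
Let fill d k := d k || (0 < k <= m.*2.+1).
Let count d j := \sum_(0 <= k < j) d k.
Let descents d j := \sum_(0 <= k < j) (d k && ~~ d k.+1).

Lemma fill_count d : count (fill d) m.*2.+2 = d 0 + m.*2.+1.
Proof.
rewrite /count big_nat_recl // /fill /= orbF; congr (_ + _).
rewrite (eq_big_nat _ _ (F2 := fun=> 1)) => [|k kP].
  by rewrite sum_nat_const_nat; lia.
by have -> : k < m.*2.+1 by []; rewrite orbT.
Qed.

(** Inside the window only the right end of the filled arc can be a descent, and [2m+2] is the first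
    position after it. *)
Lemma fill_descents d : descents (fill d) m.*2.+2 = ~~ d m.*2.+2.
Proof.
rewrite /descents big_nat_recr //= big_nat_cond big1 => [|k]; last first.
  by rewrite /fill andbT => kP; have -> : 0 < k.+1 <= m.*2.+1 by []; rewrite orbT andbF.
by rewrite /fill ltnn leqnn orbT orbF.
Qed.

(** If a descent remains at the right end, then [d] goes from true at the centre to false at [2m+2],
    so it already had a descent in between. *)
Lemma fill_descents_in d : d m.+1 -> descents (fill d) m.*2.+2 <= descents d m.*2.+2.
Proof.
move=> dm; rewrite fill_descents; case: (boolP (d _)) => //= ndm.
by apply: descent_gt0_sub dm ndm; lia.
Qed.

(** The window is cut at the centre, where [d] is false. On the left, any true position forces a
    descent before the centre, and this pays for the at most [m] true positions other than 0. On the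
    right, at most [m] positions are true, and if one is while [2m+2] is not, there is again a
    descent to pay with. *)
Lemma fill_descents_out d : ~~ d m.+1 ->
  count d m.*2.+2 + m * descents (fill d) m.*2.+2 + m.+1
    <= count (fill d) m.*2.+2 + m * descents d m.*2.+2.
Proof.
move=> ndm; rewrite fill_count fill_descents.
have split_sum (F : nat -> nat) : \sum_(0 <= k < m.*2.+2) F k =
    \sum_(0 <= k < m.+1) F k + \sum_(m.+1 <= k < m.*2.+2) F k.
  by rewrite -big_cat_nat //=; lia.
rewrite /count /descents !split_sum.
set cL := \sum_(0 <= k < m.+1) d k; set cR := \sum_(m.+1 <= k < m.*2.+2) d k.
set gL := \sum_(0 <= k < m.+1) _; set gR := \sum_(m.+1 <= k < m.*2.+2) _.
have left_side: cL <= d 0 + m * gL.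
  have [-> // | /sum_nat_bool_gt0[k kP dk]] := posnP cL.
  have gL_gt0: 0 < gL by apply: descent_gt0_sub dk ndm; lia.
  have: cL <= d 0 + m.
    rewrite /cL big_nat_recl // leq_add2l.
    by have := sum_nat_bool_le (fun k => d k.+1) 0 m; rewrite subn0.
  nia.
have right_side: cR + m * ~~ d m.*2.+2 <= m + m * gR.
  have cR_le: cR <= m.
    rewrite /cR big_ltn ?(negPf ndm); last lia.
    by have := sum_nat_bool_le d m.+2 m.*2.+2; lia.
  have [d2m | nd2m] := boolP (d m.*2.+2); first by rewrite muln0; lia.
  have [-> | /sum_nat_bool_gt0[k kP dk]] := posnP cR; first by rewrite /=; nia.
  have gR_gt0: 0 < gR by apply: descent_gt0_sub dk nd2m; lia.
  by rewrite /=; nia.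
nia.
Qed.

End Arcs.

(** * Distances on the cycle *)

Lemma cdistC n i j : cdist n i j = cdist n j i.
Proof. by rewrite /cdist addnC. Qed.

(** Here [x] and [y] need not be reduced modulo [n]. As [0 < y - x < n], their quotients differ by
    at most one, so the remainders differ by [y - x] or [n - (y - x)]. *)
Lemma cdist_far n m x y : 0 < n -> x + m < y -> y + m < x + n ->
  m < cdist n (x %% n) (y %% n).
Proof.
move=> n_gt0 far1 far2; have := divn_eq x n; have := divn_eq y n.
have := ltn_pmod x n_gt0; have := ltn_pmod y n_gt0; rewrite /cdist.
move: (x %% n) (y %% n) (x %/ n) (y %/ n) => r r' q q' lt_r' lt_r def_y def_x.
subst x y.
have : q' = q \/ q' = q.+1 by nia.
case=> ?; subst q'; lia.
Qed.

Lemma cdist_near n m x y : 0 < n -> x <= y -> y <= x + m ->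
  cdist n (x %% n) (y %% n) <= m.
Proof.
(* If [n <= m], every cyclic distance is at most [m]; otherwise [y - x < n] and the quotients again
   differ by at most one. *)
move=> n_gt0 le_xy le_yx; have [?|lt_mn] := leqP n m.
  by have := ltn_pmod x n_gt0; have := ltn_pmod y n_gt0; rewrite /cdist; lia.
have := divn_eq x n; have := divn_eq y n.
have := ltn_pmod x n_gt0; have := ltn_pmod y n_gt0; rewrite /cdist.
move: (x %% n) (y %% n) (x %/ n) (y %/ n) => r r' q q' lt_r' lt_r def_y def_x.
subst x y.
have : q' = q \/ q' = q.+1 by nia.
case=> ?; subst q'; lia.
Qed.

Lemma cpow_adjC n m (i j : 'I_n) : cpow_adj m i j = cpow_adj m j i.
Proof. by rewrite /cpow_adj eq_sym cdistC. Qed.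

Lemma in_cnbh_cpow n m (i j : 'I_n) :
  (j \in cnbh (@cpow_adj n m) i) = (cdist n i j <= m).
Proof.
rewrite inE /cpow_adj eq_sym; case: eqVneq => //= <-.
by rewrite /cdist subnn addn0 min0n.
Qed.

(** * Adding a closed neighbourhood to a set of vertices of the cycle power *)

Section CyclicSets.
Variables (n m : nat).
Hypothesis n_large : 2 * m.+1 <= n.

Let n_gt0 : 0 < n. Proof. by lia. Qed.

Definition rot_ord (k : nat) : 'I_n := Ordinal (ltn_pmod k n_gt0).

(* The number of maximal proper arcs of D. *)
Definition arcs (D : {set 'I_n}) : nat :=
  \sum_(i : 'I_n) ((i \in D) && (rot_ord i.+1 \notin D)).

Lemma arcs0 : arcs set0 = 0.
Proof. by rewrite /arcs big1 // => i _; rewrite inE. Qed.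

Lemma sum_rot_ord (F : 'I_n -> nat) a :
  \sum_(i : 'I_n) F i = \sum_(0 <= k < n) F (rot_ord (a + k)).
Proof.
rewrite big_mkord (reindex_inj (h := fun i : 'I_n => rot_ord (a + i))) //.
move=> i j /(congr1 val) /= /eqP; rewrite eqn_modDl => /eqP.
by rewrite !modn_small // => /val_inj.
Qed.

Section Step.
Variables (D : {set 'I_n}) (w : 'I_n).
(** Offset 0 is the vertex just before [N[w]], which then has offsets [1..2m+1] with [w] at [m+1];
    the summand [n] keeps the subtraction exact. *)
Let a := w + n - m.+1.
Let d k := rot_ord (a + k) \in D.
Let fill k := d k || (0 < k <= m.*2.+1).
Let D' := D :|: cnbh (@cpow_adj n m) w.

Let d_mid : d m.+1 = (w \in D).
Proof.
rewrite /d; congr (_ \in D); apply: val_inj => /=.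
by rewrite /a subnK ?modnDr ?modn_small //; lia.
Qed.

(** Offset [n] is allowed because descents look one step ahead; it is the vertex of offset 0,
    outside [N[w]] because [2m+2 <= n]. *)
Let in_D' k : k <= n -> (rot_ord (a + k) \in D') = fill k.
Proof.
move=> le_kn; rewrite /D' inE in_cnbh_cpow /fill -/(d k); congr (_ || _) => /=.
have def_w: w = (w + n) %% n :> nat by rewrite modnDr modn_small.
have [lt_k0 | le_k0] := ltnP 0 k; last first.
  by rewrite leqNgt [X in cdist n X]def_w cdistC cdist_far // /a; lia.
have [le_k | lt_k] := leqP k m.*2.+1; last first.
  by rewrite leqNgt [X in cdist n X]def_w cdist_far // /a; lia.
rewrite [X in cdist n X]def_w.
have [?|?] := leqP (w + n) (a + k); first by apply: cdist_near; rewrite /a; lia.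
by rewrite cdistC; apply: cdist_near; rewrite /a; lia.
Qed.

Let sum_split (F : nat -> nat) : \sum_(0 <= k < n) F k =
   \sum_(0 <= k < m.*2.+2) F k + \sum_(m.*2.+2 <= k < n) F k.
Proof. by rewrite -big_cat_nat //=; lia. Qed.

Let card_sum (A : {set 'I_n}) : #|A| = \sum_(0 <= k < n) (rot_ord (a + k) \in A).
Proof. by rewrite -(sum_rot_ord (fun i => (i \in A) : nat)) -sum1_card big_mkcond. Qed.

Let arcs_sum (A : {set 'I_n}) : arcs A =
  \sum_(0 <= k < n) ((rot_ord (a + k) \in A) && (rot_ord (a + k.+1) \notin A)).
Proof.
rewrite /arcs (sum_rot_ord _ a); apply: eq_bigr => k _.
congr (nat_of_bool (_ && (_ \notin A))); apply: val_inj => /=.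
by rewrite -addn1 modnDml addn1 addnS.
Qed.

Let cardD : #|D| = \sum_(0 <= k < m.*2.+2) d k + \sum_(m.*2.+2 <= k < n) d k.
Proof. by rewrite card_sum sum_split. Qed.

Let cardD' : #|D'| = \sum_(0 <= k < m.*2.+2) fill k + \sum_(m.*2.+2 <= k < n) d k.
Proof.
rewrite card_sum sum_split; congr (_ + _); apply: eq_big_nat => k kP.
  by rewrite in_D' //; lia.
rewrite in_D' /fill; last lia.
by have -> : (0 < k <= m.*2.+1) = false by [lia]; rewrite orbF.
Qed.

Let arcsD : arcs D = \sum_(0 <= k < m.*2.+2) (d k && ~~ d k.+1)
  + \sum_(m.*2.+2 <= k < n) (d k && ~~ d k.+1).
Proof. by rewrite arcs_sum sum_split. Qed.

Let arcsD' : arcs D' = \sum_(0 <= k < m.*2.+2) (fill k && ~~ fill k.+1)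
  + \sum_(m.*2.+2 <= k < n) (d k && ~~ d k.+1).
Proof.
rewrite arcs_sum sum_split; congr (_ + _); apply: eq_big_nat => k kP.
  by rewrite !in_D' //; lia.
by rewrite !in_D' /fill; lia.
Qed.

Lemma arcs_cnbh_in : w \in D -> arcs D' <= arcs D.
Proof.
move=> wD; rewrite arcsD arcsD' leq_add2r.
by apply: fill_descents_in; rewrite d_mid.
Qed.

(** Outside the window [D] and [D'] coincide, so those sums cancel and [fill_descents_out]
    remains. *)
Lemma arcs_cnbh_out : w \notin D ->
  #|D| + m * arcs D' + m.+1 <= #|D'| + m * arcs D.
Proof.
rewrite -d_mid => /fill_descents_out; rewrite -/fill arcsD arcsD' cardD cardD'.
set x1 := \sum_(_ <= _ < _) _; set x2 := \sum_(_ <= _ < _) _.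
set x3 := \sum_(_ <= _ < _) _; set x4 := \sum_(_ <= _ < _) _.
rewrite !mulnDr; lia.
Qed.

(** Serves the first vertex read, whose neighbourhood has to pay for the extra [m] charged when [J]
    is a singleton. *)
Lemma card_cnbh_ge : m.*2.+1 <= #|D'|.
Proof. by rewrite cardD' (fill_count m d) -addnA addnCA leq_addr. Qed.

End Step.

End CyclicSets.

(** * Closed neighbourhoods in a join *)

Section XJoin.
Variables (V : finType) (eG : rel V) (T : V -> finType) (E : forall v, rel (T v)).
Arguments E : clear implicits.

Lemma cnbh_xjoin_same v (a b : T v) :
  (Tagged T b \in cnbh (xjoin eG E) (Tagged T a)) = (b \in cnbh (E v) a).
Proof. by rewrite !inE /xjoin /= eqxx tagged_asE eq_Tagged. Qed.

Lemma cnbh_xjoin_diff (x y : {v & T v}) : tag x != tag y ->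
  (y \in cnbh (xjoin eG E) x) = eG (tag x) (tag y).
Proof.
move=> neq_xy; rewrite inE /xjoin (negPf neq_xy).
by case: eqP => // eq_xy; rewrite eq_xy eqxx in neq_xy.
Qed.

(** Contrapositively, a tag that no earlier tag dominates has its whole factor undominated. *)
Lemma cnbh_xjoin_tag (x y : {v & T v}) :
  y \in cnbh (xjoin eG E) x -> tag y \in cnbh eG (tag x).
Proof.
have [eq_xy | neq_xy] := eqVneq (tag x) (tag y).
  by rewrite eq_xy mem_cnbh.
by rewrite cnbh_xjoin_diff // !inE => ->; rewrite orbT.
Qed.

End XJoin.

(** * The upper bound *)

Section UpperBound.
Variables (n m : nat) (T : 'I_n -> finType) (E : forall v, rel (T v)).
Arguments E : clear implicits.
Hypothesis n_large : 2 * m.+1 <= n.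
Local Notation G := (@cpow_adj n m).
Local Notation X := (xjoin G E).
Implicit Types (s : seq {v & T v}) (J I : {set 'I_n}) (L : forall v, seq (T v)).

Definition tag_nbhd s := \bigcup_(z <- s) cnbh G (tag z).

Lemma tag_nbhd_rcons s x : tag_nbhd (rcons s x) = tag_nbhd s :|: cnbh G (tag x).
Proof. by rewrite /tag_nbhd -cats1 big_cat big_seq1. Qed.

Lemma tag_nbhdP s v :
  reflect (exists2 z, z \in s & v \in cnbh G (tag z)) (v \in tag_nbhd s).
Proof.
rewrite /tag_nbhd -(big_map (fun z : {v & T v} => tag z) predT (cnbh G)).
apply: (iffP (bigcup_seqP _ _ _)) => [[_ /mapP[z zs ->] zv] | [z zs zv]].
  by exists z.
by exists (tag z) => //; apply: map_f.
Qed.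

(* The maximum matters only when J has one element: the bound must then leave room
   for a second vertex, and the first arc, of size 2m+1, provides the missing m. *)
Definition bound_invariant s J L : Prop :=
  [/\ [/\ {in J &, forall u v, ~~ G u v}, {subset J <= map tag s}
        & s != [::] -> 0 < #|J|],
      forall v, legal_seq (E v) (L v),
      forall v, v \in map tag s -> (forall z, z \in s -> ~~ G (tag z) v) ->
        v \in J /\ forall a, a \in L v -> Tagged T a \in s
    & size s + m.+1 * #|J| + m * maxn (arcs n_large (tag_nbhd s)) (#|J| == 1)
        <= #|tag_nbhd s| + \sum_(v in J) size (L v)].

(** Induction on the last vertex [x], with footprint [y]. If the tag of [x] is undominated, it joins
    [J] with a one-term sequence. Otherwise the number of arcs does not grow, and either the tag of
    [y] becomes dominated, or it lies in [J] and its sequence gains a term. *)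
Lemma bound_invariant_exists s :
  legal_seq X s -> exists J L, bound_invariant s J L.
Proof.
elim/last_ind: s => [_ | s x IHs /legal_seq_rcons[leg_s [y yx y_undom]]].
  exists set0, (fun=> [::]); split=> //; last first.
    by rewrite /tag_nbhd big_nil !cards0 big_set0 arcs0 !muln0.
  - by move=> v [].
  by split=> // [u v|u]; rewrite inE.
have [J [L [[indJ sJs Jn0] legL LJ size_le]]] := IHs leg_s.
have in_rcons z : z \in s -> z \in rcons s x by rewrite mem_rcons inE orbC => ->.
have rcons_neq0 : rcons s x != [::] by rewrite -size_eq0 size_rcons.
have tag_nbhd_tag u : u \in map tag s -> u \in tag_nbhd s.
  by case/mapP=> z zs ->; apply/tag_nbhdP; exists z; rewrite ?mem_cnbh.
have [xD | xD] := boolP (tag x \in tag_nbhd s); last first.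
  have xJ : tag x \notin J by apply: contra xD => /sJs /tag_nbhd_tag.
  have x_nonadj u : u \in map tag s -> ~~ G u (tag x).
    case/mapP=> z zs ->; apply: contra xD => Gz; apply/tag_nbhdP; exists z => //.
    by rewrite inE Gz orbT.
  exists (tag x |: J), (dfwith L [:: tagged x]); split.
  - split=> [u v|u|_]; last by rewrite cardsU1 xJ.
      rewrite !inE => /predU1P[->|uJ] /predU1P[->|vJ].
      - by rewrite /cpow_adj eqxx.
      - by rewrite cpow_adjC x_nonadj ?sJs.
      - by rewrite x_nonadj ?sJs.
      exact: indJ.
    rewrite map_rcons mem_rcons !inE => /predU1P[->|/sJs->].
      by rewrite eqxx.
    by rewrite orbT.
  - move=> v; have [<-|neq_v] := eqVneq (tag x) v; last by rewrite dfwith_out.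
    rewrite dfwith_in => -[|z [|]] //= z' s2 [<- _].
    by exists (tagged x); first exact: mem_cnbh.
  - move=> v; rewrite map_rcons mem_rcons !inE => /predU1P[->|vs] nadj_v.
      rewrite eqxx; split=> // a; rewrite dfwith_in inE => /eqP->.
      by case: (x) => u b; rewrite mem_rcons mem_head.
    have [|vJ Lv] := LJ v vs; first by move=> z zs; apply: nadj_v; apply: in_rcons.
    rewrite vJ orbT; split=> // a; rewrite dfwith_out => [/Lv/in_rcons //|].
    by apply: contraNneq xJ => ->.
  rewrite tag_nbhd_rcons size_rcons big_setU1 //= dfwith_in cardsU1 xJ /=.
  have -> : \sum_(v in J) size (dfwith L [:: tagged x] v) = \sum_(v in J) size (L v).
    apply: eq_bigr => v vJ; rewrite dfwith_out //.
    by apply: contraNneq xJ => ->.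
  have := arcs_cnbh_out n_large xD.
  have := card_cnbh_ge n_large (tag_nbhd s) (tag x).
  have [s0 | /Jn0 J_gt0] := eqVneq s [::].
    have J0 : J = set0.
      by apply/setP=> u; rewrite inE; apply/negP=> /sJs; rewrite s0.
    have D0 : tag_nbhd s = set0 by rewrite s0 /tag_nbhd big_nil.
    (* For the first vertex, the case of no arc is settled by [card_cnbh_ge] and the other by
       [arcs_cnbh_out]. *)
    rewrite J0 D0 cards0 big_set0 s0 arcs0 /=.
    move: #|_ :|: _| (arcs _ _) => c [|k] /=; clear.
      by rewrite max0n; lia.
    by rewrite maxnSS maxn0; lia.
  have -> : (1 + #|J| == 1) = false by lia.
  have := leq_mul (leqnn m) (leq_maxl (arcs n_large (tag_nbhd s)) (#|J| == 1)).
  move: size_le; rewrite maxn0 mulnDr.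
  move: (m.+1 * #|J|) (m * maxn _ _) #|_ :|: _| (\sum_(_ in _) _) => j b c t.
  move: (m * arcs _ _) (m * arcs _ _) #|_| => g g' d; clear.
  by lia.
have yx_tag := cnbh_xjoin_tag yx.
have le_arcs: arcs n_large (tag_nbhd (rcons s x)) <= arcs n_large (tag_nbhd s).
  by rewrite tag_nbhd_rcons arcs_cnbh_in.
have le_maxn: maxn (arcs n_large (tag_nbhd (rcons s x))) (#|J| == 1)
     <= maxn (arcs n_large (tag_nbhd s)) (#|J| == 1) by lia.
have {le_maxn} le_mul := leq_mul (leqnn m) le_maxn.
(* A tag without read neighbours is not new: were it the tag of [x], it would be dominated by
   earlier tags, hence, adjacency being excluded, equal to one of them. *)
have old_tag v : v \in map tag (rcons s x) ->
    (forall z, z \in rcons s x -> ~~ G (tag z) v) ->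
  [/\ v \in map tag s, forall z, z \in s -> ~~ G (tag z) v & v \in J].
  move=> vs nadj_v.
  have nadj_v' z : z \in s -> ~~ G (tag z) v by move/in_rcons; apply: nadj_v.
  have vs': v \in map tag s.
    move: vs; rewrite map_rcons mem_rcons inE => /predU1P[def_v|//].
    move: xD; rewrite -def_v => /tag_nbhdP[z zs].
    by rewrite inE (negPf (nadj_v' _ zs)) orbF => /eqP->; apply: map_f.
  by have [vJ _] := LJ v vs' nadj_v'.
have sJs' : {subset J <= map tag (rcons s x)}.
  by move=> u /sJs; rewrite map_rcons mem_rcons inE orbC => ->.
have J_gt0: 0 < #|J|.
  by apply: Jn0; apply: contraTneq xD => ->; rewrite /tag_nbhd big_nil inE.
have [yD | yD] := boolP (tag y \in tag_nbhd s); last first.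
  exists J, L; split=> //.
    move=> v vs nadj_v; have [vs' nadj_v' vJ] := old_tag v vs nadj_v.
    by split=> // a; have [_ Lv] := LJ v vs' nadj_v' => /Lv/in_rcons.
  rewrite size_rcons.
  suff: #|tag_nbhd s| < #|tag_nbhd (rcons s x)| by lia.
  apply: proper_card; apply/properP; rewrite tag_nbhd_rcons; split.
    exact: subsetUl.
  by exists (tag y); rewrite // inE yx_tag orbT.
(* A read neighbour of this tag would dominate its whole factor, [y] included. *)
have nadj_y z : z \in s -> ~~ G (tag z) (tag y).
  move=> zs; apply: contra (y_undom z zs) => Gzy.
  by rewrite cnbh_xjoin_diff //; case/andP: Gzy.
have ys : tag y \in map tag s.
  case/tag_nbhdP: yD => z zs.
  by rewrite inE (negPf (nadj_y z zs)) orbF => /eqP->; apply: map_f.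
have [yJ Ly] := LJ _ ys nadj_y.
have undom_y a : a \in L (tag y) -> tagged y \notin cnbh (E (tag y)) a.
  move/Ly/y_undom; case: (y) a => /= v b a.
  by rewrite cnbh_xjoin_same.
(* If x lies in another factor, y itself may replace it in the factor of y. *)
have [c [yc xc]] : exists c, tagged y \in cnbh (E (tag y)) c /\
    (~~ G (tag x) (tag y) -> Tagged T c = x).
  have [eq_xy | neq_xy] := eqVneq (tag x) (tag y).
    case: (x) (y) eq_xy yx => /= v a [w b] /= eq_vw.
    move: b; rewrite -eq_vw => b; rewrite cnbh_xjoin_same => ab.
    by exists a.
  exists (tagged y); split; first exact: mem_cnbh.
  by move: yx; rewrite cnbh_xjoin_diff // => ->.
exists J, (dfwith L (rcons (L (tag y)) c)); split=> //.
- move=> v; have [<-|neq_v] := eqVneq (tag y) v; last by rewrite dfwith_out.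
  rewrite dfwith_in; apply/legal_seq_rcons; split=> //.
  by exists (tagged y).
- move=> v vs nadj_v; have [vs' nadj_v' vJ] := old_tag v vs nadj_v.
  split=> // a; have [_ Lv] := LJ v vs' nadj_v'.
  have [def_v|neq_v] := eqVneq (tag y) v; last by rewrite dfwith_out // => /Lv/in_rcons.
  move: a; rewrite -def_v dfwith_in => a; rewrite mem_rcons inE => /predU1P[->|].
    (* If [c] were not [x], the tag of [x] would be adjacent to [v], contrary to [nadj_v]. *)
    by rewrite xc ?def_v ?nadj_v // mem_rcons mem_head.
  by move/Ly/in_rcons.
rewrite size_rcons (bigD1 (tag y)) //= dfwith_in size_rcons.
have -> : \sum_(v in J | v != tag y) size (dfwith L (rcons (L (tag y)) c) v)
    = \sum_(v in J | v != tag y) size (L v).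
  by apply: eq_bigr => v /andP[_ neq_v]; rewrite dfwith_out // eq_sym.
have: #|tag_nbhd s| <= #|tag_nbhd (rcons s x)|.
  by rewrite tag_nbhd_rcons subset_leq_card ?subsetUl.
move: size_le le_mul; rewrite (bigD1 (tag y)) //=.
set b := m * maxn _ _; set b' := m * maxn (arcs _ (tag_nbhd (rcons _ _))) _.
move: b b' (m.+1 * _) (\sum_(_ in _ | _) _) #|tag_nbhd s| #|tag_nbhd _| (size (L _)).
by move=> b b' j t d d' l; clear; lia.
Qed.

Lemma I2P I : reflect ({in I &, forall u v, ~~ G u v} /\ 1 < #|I|) (I2 m I).
Proof.
apply: (iffP andP) => -[indI cardI]; split=> //.
  by move=> u v uI vI; apply: (forall_inP (forall_inP indI u uI) v vI).
apply/forall_inP=> u uI; apply/forall_inP=> v vI.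
exact: indI.
Qed.

(** One way round, [v] and [v + m + 1] are [m+1] apart; the other way they are [n - (m+1)] apart,
    which is at least [m+1]. *)
Lemma I2_pair (v : 'I_n) : exists w, v != w /\ I2 m [set v; w].
Proof.
pose w := rot_ord n_large (v + m.+1); exists w.
have far : m < cdist n v w.
  have /modn_small def_v := ltn_ord v.
  by rewrite /= -[X in cdist n X]def_v cdist_far //; lia.
have neq_vw : v != w.
  by apply: contraTneq far => <-; rewrite /cdist subnn addn0 min0n.
split=> //; apply/I2P; split; last by rewrite cards2 neq_vw.
have Gvw : ~~ G v w by rewrite /cpow_adj neq_vw -ltnNge.
move=> a b; rewrite !inE => /pred2P[] -> /pred2P[] -> //.
- by rewrite /cpow_adj eqxx.
- by rewrite cpow_adjC.
by rewrite /cpow_adj eqxx.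
Qed.

Hypothesis T_gt0 : forall v, 0 < #|T v|.

Lemma gamma_xjoin_le : exists2 I, I2 m I &
  gamma_gr X + #|I| * m.+1 <= \sum_(v in I) gamma_gr (E v) + n.
Proof.
have [s /andP[/legal_dom_seqP[leg_s _] /eqP <-]] := gamma_gr_attained X.
have [J [L [[indJ _ Jn0] legL _ size_le]]] := bound_invariant_exists leg_s.
have le_L : \sum_(v in J) size (L v) <= \sum_(v in J) gamma_gr (E v).
  by apply: leq_sum => v _; apply: legal_seq_gamma.
have le_D : #|tag_nbhd s| <= n by rewrite -[leqRHS]card_ord max_card.
have {size_le le_L le_D} size_le :
    size s + #|J| * m.+1 + m * (#|J| == 1) <= \sum_(v in J) gamma_gr (E v) + n.
  rewrite [leqRHS]addnC; apply: leq_trans (leq_add le_D le_L); apply: leq_trans size_le.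
  by rewrite mulnC leq_add2l leq_mul2l leq_maxr orbT.
have pair_gamma v w : v != w ->
    gamma_gr (E v) < \sum_(u in [set v; w]) gamma_gr (E u).
  move=> neq_vw; rewrite big_setU1 ?inE //= big_set1.
  by rewrite -addn1 leq_add2l gamma_gr_gt0.
have [J_gt1|] := ltnP 1 #|J|.
  exists J; first exact/I2P.
  by apply: leq_trans size_le; apply: leq_addr.
(* For a singleton [J], the second vertex costs [m+1]: the singleton term provides [m], and the
   positive Grundy number of the new factor provides 1. *)
rewrite leq_eqVlt => /predU1P[/eqP /cards1P[v def_J] | J_lt1].
  have [w [neq_vw I2vw]] := I2_pair v; exists [set v; w] => //.
  have := pair_gamma v w neq_vw; rewrite cards2 neq_vw.
  move: size_le; rewrite def_J cards1 big_set1.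
  by move: (\sum_(_ in _) _) (gamma_gr _) => t g; clear; lia.
(* An empty [J] forces an empty [s], and then any pair works because [2(m+1) <= n]. *)
have [v _] : exists v : 'I_n, true by have n_gt0: 0 < n by [lia]; exists (Ordinal n_gt0).
have [w [neq_vw I2vw]] := I2_pair v; exists [set v; w] => //.
have := pair_gamma v w neq_vw; rewrite cards2 neq_vw.
have -> : s = [::] by apply/eqP; apply: contraLR J_lt1 => /Jn0; rewrite -leqNgt.
by rewrite /=; lia.
Qed.

End UpperBound.

(** * Splitting concatenated, flattened and mapped lists *)

Section SeqSplit.
Variables (A B : Type).

Lemma cat_split (s1 s2 l1 : seq A) k l2 : s1 ++ s2 = l1 ++ k :: l2 ->
  (exists l, s1 = l1 ++ k :: l) \/ (exists2 l, l1 = s1 ++ l & s2 = l ++ k :: l2).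
Proof.
elim: s1 l1 => [|x s1 IHs] l1 /=; first by right; exists l1.
case: l1 => [|x' l1] /= [<-]; first by move=> _; left; exists s1.
case/IHs=> [[l ->] | [l -> ->]]; first by left; exists l.
by right; exists l.
Qed.

Lemma flatten_split (F : B -> seq A) (l : seq B) s1 x s2 :
  flatten (map F l) = s1 ++ x :: s2 ->
  exists l1 k l2 t1 t2, [/\ l = l1 ++ k :: l2, F k = t1 ++ x :: t2
                          & s1 = flatten (map F l1) ++ t1].
Proof.
elim: l s1 => [|k l IHl] s1 /=; first by case: s1.
case/cat_split=> [[t def_k] | [t -> /IHl[l1 [k' [l2 [t1 [t2 [-> Fk' ->]]]]]]]].
  by exists [::], k, l, s1, t.
by exists (k :: l1), k', l2, t1, t2; rewrite /= catA.
Qed.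

Lemma map_split (f : B -> A) (l : seq B) s1 x s2 : map f l = s1 ++ x :: s2 ->
  exists l1 k l2, [/\ l = l1 ++ k :: l2, f k = x & map f l2 = s2].
Proof.
elim: s1 l => [|y s1 IHs] [|k l] //= [].
  by move=> <- <-; exists [::], k, l.
by move=> _ /IHs[l1 [k' [l2 [-> <- <-]]]]; exists (k :: l1), k', l2.
Qed.

End SeqSplit.

Lemma pairwise_split_l (A : eqType) (r : rel A) l1 k l2 u :
  pairwise r (l1 ++ k :: l2) -> u \in l1 -> r u k.
Proof. by rewrite pairwise_cat => /and3P[/allrelP rl _ _] /rl; apply; rewrite mem_head. Qed.

Lemma pairwise_split_r (A : eqType) (r : rel A) l1 k l2 u :
  pairwise r (l1 ++ k :: l2) -> u \in l2 -> r k u.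
Proof. by rewrite pairwise_cat /= => /and3P[_ _ /andP[/allP rk _]] /rk. Qed.

Lemma pairwise_iota a k : pairwise ltn (iota a k).
Proof. by rewrite -sorted_pairwise ?iota_ltn_sorted //; apply: ltn_trans. Qed.

(** * The increasing blocks of [S_C(I)] *)

Section Blocks.
Variable (m : nat).
Local Notation spaced := (fun a b => a + m < b).

(** The part [S_1, ..., S_(p-1)] of [S_C(I)], by recursion on the sorted members [x :: s] of [I];
    [blocksE] links it to the indexed form in [SC]. *)
Fixpoint blocks (x : nat) (s : seq nat) : seq nat :=
  if s is y :: s' then iota x (y - m - x) ++ blocks y s' else [::].

Lemma blocksE x s :
  flatten [seq iota (nth 0 (x :: s) j) (nth 0 (x :: s) j.+1 - m - nth 0 (x :: s) j)
          | j <- iota 0 (size s)] = blocks x s.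
Proof.
elim: s x => // y s IHs x; rewrite [iota 0 _]/= map_cons /=; congr (_ ++ _).
by rewrite (iotaDl 1 0) -map_comp; apply: IHs.
Qed.

Lemma spaced_le_last x s : path spaced x s -> x <= last x s.
Proof.
by elim: s x => //= y s IHs x /andP[xy /IHs]; apply: leq_trans; lia.
Qed.

Lemma spaced_mem x s k : path spaced x s -> k \in s -> x + m < k.
Proof.
elim: s x => //= y s IHs x /andP[xy ys]; rewrite inE => /predU1P[-> //|/(IHs _ ys)].
lia.
Qed.

Lemma mem_blocks_bounds x s u :
  path spaced x s -> u \in blocks x s -> x <= u /\ u + m < last x s.
Proof.
elim: s x => //= y s IHs x /andP[xy ys]; rewrite mem_cat => /orP[|/(IHs _ ys)]; last lia.
by have := spaced_le_last ys; rewrite mem_iota; lia.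
Qed.

Lemma blocks_pairwise x s : path spaced x s -> pairwise ltn (blocks x s).
Proof.
elim: s x => //= y s IHs x /andP[xy ys].
rewrite pairwise_cat pairwise_iota IHs //= andbT; apply/allrelP=> u v.
by rewrite mem_iota => uP /(mem_blocks_bounds ys)[]; lia.
Qed.

(** This is why a member of [I] is not dominated by the block entries before it. *)
Lemma blocks_gap x s u k : path spaced x s ->
  u \in blocks x s -> k \in x :: s -> u < k -> u + m < k.
Proof.
elim: s x => //= y s IHs x /andP[xy ys]; rewrite mem_cat inE.
case/orP=> [uP | uP] /predU1P[->|ks] lt_uk; first by move: uP; rewrite mem_iota; lia.
- move: ks; rewrite inE => /predU1P[-> | /(spaced_mem ys) ky].
    by move: uP; rewrite mem_iota; lia.
  by move: uP; rewrite mem_iota; lia.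
- by have := mem_blocks_bounds ys uP; lia.
exact: IHs uP ks lt_uk.
Qed.

Lemma mem_blocks x s k :
  path spaced x s -> k \in x :: s -> k < last x s -> k \in blocks x s.
Proof.
elim: s x => [|y s IHs] x /=; first by rewrite inE => _ /eqP->; rewrite ltnn.
case/andP=> xy ys; rewrite inE mem_cat => /predU1P[-> _ | ks lt_k].
  by rewrite mem_iota; apply/orP; left; lia.
by rewrite (IHs y) ?orbT.
Qed.

Lemma blocks_dominate x s v : 0 < m -> path spaced x s -> v \notin x :: s ->
  x <= v -> v < last x s -> exists2 u, u \in blocks x s & u < v <= u + m.
Proof.
move=> m_gt0; elim: s x => [|y s IHs] x /=; first by move=> *; lia.
case/andP=> xy ys; rewrite inE negb_or => /andP[neq_vx vys] le_xv lt_v.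
have [le_yv | lt_vy] := leqP y v.
  by have [u uP uv] := IHs y ys vys le_yv lt_v; exists u; rewrite // mem_cat uP orbT.
(* The predecessor [v - 1] serves while it lies in the block; beyond that, the last entry
   [y - m - 1] still reaches up to [y - 1]. *)
by exists (minn v.-1 (y - m - 1)); rewrite ?mem_cat ?mem_iota; lia.
Qed.

(** Each block is shorter by [m] than the gap between its two members, and the gaps telescope. *)
Lemma size_blocks x s : path spaced x s -> size (blocks x s) + size s * m + x = last x s.
Proof.
elim: s x => [|y s IHs] x /=; first by rewrite mul0n.
by case/andP=> xy /IHs <-; rewrite size_cat size_iota mulSn; lia.
Qed.

End Blocks.

(** * The whole of [S_C(I)] as a sequence of natural numbers *)

Section CanonicalSequence.
Variables (n m x : nat) (s : seq nat).
Hypotheses (m_gt0 : 0 < m) (spaced_s : path (fun a b => a + m < b) x s).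
Hypotheses (s_neq0 : s != [::]) (last_lt : last x s < n).
Hypothesis (wrap : last x s + m < x + n).
Local Notation z := (last x s).

(** The part [S_p] before its reversal: it runs from [z + m + 1] to [x + n - 1] modulo [n], and is
    empty if [z + m + 1 = x + n]. *)
Definition wrap_seq := [seq (z + k) %% n | k <- iota m.+1 (x + n - z - m.+1)].
Definition canonical_seq := blocks m x s ++ rev wrap_seq ++ [:: z].

Let n_gt0 : 0 < n. Proof. exact: leq_ltn_trans last_lt. Qed.

Let xz : x + m < z.
Proof.
apply: (spaced_mem spaced_s).
by case: (s) s_neq0 => //= y t _; apply: mem_last.
Qed.

Lemma canonical_seq_lt k : k \in canonical_seq -> k < n.
Proof.
rewrite !mem_cat mem_rev inE => /or3P[/(mem_blocks_bounds spaced_s)||/eqP->//].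
  lia.
by case/mapP=> t _ ->; apply: ltn_pmod.
Qed.

Lemma size_canonical_seq : size canonical_seq + (size s).+1 * m = n.
Proof.
have := size_blocks spaced_s.
rewrite !size_cat size_rev size_map size_iota /= mulSn; lia.
Qed.

Lemma wrap_notin t : z < z + t < x + n -> (z + t) %% n \notin x :: s.
Proof.
move=> tP; have le_xz k : k \in x :: s -> x <= k <= z.
  elim: (s) x spaced_s => [|y u IHu] v /=; first by rewrite inE => _ /eqP->; rewrite leqnn.
  case/andP=> vy yu; rewrite inE => /predU1P[->|/(IHu _ yu)]; last lia.
  by have := spaced_le_last yu; lia.
apply: (contraNN (le_xz _)); have [lt_n|le_n] := ltnP (z + t) n.
  by rewrite modn_small //; lia.
have -> : z + t = (z + t - n) + n by lia.
by rewrite modnDr modn_small; lia.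
Qed.

(** Members of [I] footprint themselves, which permits their replacement. Any other block entry [k]
    footprints [k + m]; a wrapped entry [z + t] footprints [z + t - m], as that part is read
    downwards. *)
Lemma canonical_seq_footprint l1 k l2 : canonical_seq = l1 ++ k :: l2 ->
  exists w, [/\ w < n, cdist n k w <= m, forall u, u \in l1 -> m < cdist n u w
              & k \in x :: s -> w = k].
Proof.
have small u : u < n -> u = u %% n by move=> ?; rewrite modn_small.
move=> def_C; have [[l def_A] | [l -> def_WZ]] := cat_split def_C; last first.
  have [[l' def_W] | [l' -> def_z]] := cat_split def_WZ; last first.
    have [-> def_k]: l' = [::] /\ k = z.
      by case: l' def_z => [|? [|]] //= [->].
    exists z; rewrite def_k; split=> //; first by rewrite /cdist subnn min0n.
    move=> u; rewrite cats0 mem_cat mem_rev => /orP[uA | /mapP[t]].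
      by have := mem_blocks_bounds spaced_s uA; rewrite /cdist; lia.
    rewrite mem_iota => tP ->; rewrite [X in cdist n _ X]small //.
    by rewrite cdistC; apply: cdist_far; lia.
  (* Once the reversal is undone, the entries read before [k] are those with larger offsets. *)
  have revW : wrap_seq = rev l' ++ k :: rev l.
    by rewrite -[LHS]revK def_W rev_cat rev_cons cat_rcons.
  have [i1 [t [i2 [def_i def_k def_l]]]] := map_split revW.
  have tP : m.+1 <= t < x + n - z.
    have : t \in iota m.+1 (x + n - z - m.+1) by rewrite def_i mem_cat mem_head orbT.
    by rewrite mem_iota; lia.
  exists ((z + t - m) %% n); split; first exact: ltn_pmod.
  - by rewrite -def_k cdistC; apply: cdist_near; lia.
  - move=> u; rewrite mem_cat => /orP[uA|].
      have [xu uz] := mem_blocks_bounds spaced_s uA.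
      by rewrite (small u); [apply: cdist_far; lia | lia].
    rewrite -mem_rev -def_l => /mapP[t' t'i ->].
    have t'P : t' < x + n - z.
      have : t' \in iota m.+1 (x + n - z - m.+1).
        by rewrite def_i mem_cat inE t'i !orbT.
      by rewrite mem_iota; lia.
    have := pairwise_iota m.+1 (x + n - z - m.+1).
    rewrite def_i => /pairwise_split_r/(_ t'i) /= lt_t.
    by rewrite cdistC; apply: cdist_far; lia.
  by rewrite -def_k => /idPn[]; apply: wrap_notin; lia.
have kA : k \in blocks m x s by rewrite def_A mem_cat mem_head orbT.
have [xk kz] := mem_blocks_bounds spaced_s kA.
have lt_k u : u \in l1 -> [/\ u \in blocks m x s, u < k, x <= u & u + m < z].
  move=> ul; have uA : u \in blocks m x s by rewrite def_A mem_cat ul.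
  have [xu uz] := mem_blocks_bounds spaced_s uA; split=> //.
  have := blocks_pairwise spaced_s; rewrite def_A => /pairwise_split_l.
  exact.
have [ks | ks] := boolP (k \in x :: s).
  exists k; split=> //; first lia.
    by rewrite /cdist subnn min0n.
  move=> u /lt_k[uA uk xu uz]; have := blocks_gap spaced_s uA ks uk.
  by rewrite /cdist; lia.
exists (k + m); split=> //; first lia.
  by rewrite /cdist; lia.
by move=> u /lt_k[uA uk xu uz]; rewrite /cdist; lia.
Qed.

Lemma mem_canonical_seq k : k \in x :: s -> k \in canonical_seq.
Proof.
move=> ks; rewrite !mem_cat inE; have [-> | neq_kz] := eqVneq k z; first by rewrite !orbT.
suff lt_kz : k < z by rewrite (mem_blocks spaced_s).
rewrite ltn_neqAle neq_kz /=.
elim: (s) x spaced_s ks => [|y u IHu] v /=; first by rewrite inE => _ /eqP->.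
case/andP=> vy yu; rewrite inE => /predU1P[->|/(IHu _ yu)//].
by have := spaced_le_last yu; lia.
Qed.

(** The dominating [u] must differ from [v]: a single representative need not dominate its own
    factor, while a neighbour dominates all of it. *)
Lemma canonical_seq_dominates v : v < n -> v \notin x :: s ->
  exists2 u, u \in canonical_seq & (u != v) && (cdist n u v <= m).
Proof.
move=> lt_vn vs.
have [/andP[xv vz] | v_out] := boolP (x <= v < z).
  have [u uA uP] := blocks_dominate m_gt0 spaced_s vs xv vz.
  by exists u; rewrite ?mem_cat ?uA //= /cdist; lia.
have neq_vx : v != x by apply: contraNneq vs => ->; rewrite mem_head.
have neq_vz : v != z by apply: contraNneq vs => ->; rewrite mem_last.
have [t [tP def_v]] : exists t, 0 < t < x + n - z /\ v = (z + t) %% n.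
  have [lt_zv | le_vz] := ltnP z v.
    by exists (v - z); rewrite subnKC 1?modn_small //; lia.
  exists (v + n - z); split; first lia.
  by rewrite subnKC ?modnDr ?modn_small //; lia.
(* On the wrapped stretch, [v] is dominated by [z] up to offset [m], then by the next vertex as long
   as it precedes [x], and finally by [x]. *)
have [le_tm | lt_mt] := leqP t m.
  exists z; first by rewrite !mem_cat mem_head !orbT.
  rewrite eq_sym neq_vz def_v -[z in cdist n z _](modn_small last_lt).
  by apply: cdist_near; lia.
have [lt_t1 | ge_t1] := ltnP t.+1 (x + n - z).
  exists ((z + t.+1) %% n).
    rewrite !mem_cat mem_rev; apply/or3P/Or32/mapP; exists t.+1 => //.
    by rewrite mem_iota; lia.
  apply/andP; split; last by rewrite def_v cdistC; apply: cdist_near; lia.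
  have : 0 < cdist n (v %% n) ((z + t.+1) %% n).
    rewrite def_v modn_mod; apply: cdist_far; lia.
  by apply: contraTneq => ->; rewrite modn_small // /cdist subnn min0n.
exists x; first by apply: mem_canonical_seq; rewrite mem_head.
rewrite eq_sym neq_vx def_v -[x in cdist n x _](@modn_small x n); last lia.
by rewrite -modnDr cdistC; apply: cdist_near; lia.
Qed.

End CanonicalSequence.

(** * The lower bound *)

Section LowerBound.
Variables (n m : nat) (I : {set 'I_n}).
Hypotheses (m_gt0 : 0 < m) (I2I : I2 m I).
Local Notation G := (@cpow_adj n m).

Lemma SC_ordinals : exists l : seq 'I_n,
  [/\ SC m I = map val l,
      forall l1 k l2, l = l1 ++ k :: l2 ->
        exists w, [/\ w \in cnbh G k, forall u, u \in l1 -> w \notin cnbh G u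
                    & k \in I -> w = k],
      {subset I <= l}, forall v, v \notin I -> exists2 u, u \in l & G u v
    & size l + #|I| * m = n].
Proof.
have [indI cardI] := I2P _ _ I2I.
rewrite /SC; set s := sort leq _.
have mem_s (v : 'I_n) : (val v \in s) = (v \in I).
  by rewrite mem_sort mem_image //; apply: val_inj.
have s_I k : k \in s -> exists2 v, v \in I & k = val v.
  by rewrite mem_sort => /imageP.
have size_s : size s = #|I| by rewrite size_sort size_image.
have far a b : a \in s -> b \in s -> a < b -> m < cdist n a b.
  move=> /s_I[u uI ->] /s_I[v vI ->] lt_uv; rewrite ltnNge; apply/negP=> le_uv.
  by have := indI u v uI vI; rewrite /cpow_adj le_uv andbT -val_eqE neq_ltn lt_uv.
have spaced_s : sorted (fun a b => a + m < b) s.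
  apply: (@sub_in_sorted _ (mem s) ltn); last first.
  - rewrite ltn_sorted_uniq_leq sort_sorted ?andbT; last exact: leq_total.
    by rewrite sort_uniq map_inj_uniq ?enum_uniq //; apply: val_inj.
  - exact/allP.
  by move=> a b a_s b_s lt_ab; have := far a b a_s b_s lt_ab; rewrite /cdist; lia.
case def_s: s spaced_s size_s => [|x t] /= spaced_s size_s; first by rewrite -size_s in cardI.
have t_neq0 : t != [::] by move: cardI; rewrite -size_s; case: (t).
have z_s : last x t \in s by rewrite def_s mem_last.
have x_s : x \in s by rewrite def_s mem_head.
have z_lt : last x t < n by have [v _ ->] := s_I _ z_s; apply: ltn_ord.
have lt_xz : x + m < last x t.
  by apply: (spaced_mem spaced_s); case: (t) t_neq0 => //= y t' _; apply: mem_last.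
have wrap : last x t + m < x + n.
  have lt_xz' : x < last x t by apply: leq_ltn_trans lt_xz; apply: leq_addr.
  by have := far _ _ x_s z_s lt_xz'; rewrite /cdist; lia.
rewrite (blocksE m x t) -/(wrap_seq n m x t) -/(canonical_seq n m x t).
have ltC k : k \in canonical_seq n m x t -> k < n.
  exact: (canonical_seq_lt m_gt0 spaced_s t_neq0 z_lt wrap).
(* All entries are below [n], so [insub] discards nothing. *)
pose l := pmap (insub : nat -> option 'I_n) (canonical_seq n m x t).
have def_C : canonical_seq n m x t = map val l.
  rewrite /l; elim: (canonical_seq n m x t) ltC => //= k C IHC ltC.
  rewrite [in RHS]insubT /= ?ltC ?mem_head // => lt_k.
  by rewrite -IHC // => j jC; apply: ltC; rewrite inE jC orbT.
exists l; split=> //.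
- move=> l1 k l2 def_l; have := def_C; rewrite def_l map_cat /=.
  case/(canonical_seq_footprint m_gt0 spaced_s t_neq0 z_lt wrap) => w [lt_w kw lw sw].
  exists (Ordinal lt_w); split=> [|u ul|kI]; first by rewrite in_cnbh_cpow.
    by rewrite in_cnbh_cpow -ltnNge lw // map_f.
  by apply: val_inj; rewrite /= sw // -def_s mem_s.
- move=> v; rewrite -mem_s def_s => /(mem_canonical_seq m_gt0 spaced_s t_neq0 z_lt wrap).
  by rewrite def_C mem_map //; apply: val_inj.
- move=> v; rewrite -mem_s def_s.
  case/(canonical_seq_dominates m_gt0 spaced_s t_neq0 z_lt wrap (ltn_ord v)) => u.
  rewrite def_C => /mapP[u' u'l ->] /andP[neq_u le_u].
  by exists u' => //; rewrite /cpow_adj -val_eqE neq_u.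
by rewrite -size_s -(size_map val) -def_C; apply: size_canonical_seq.
Qed.

Variables (T : 'I_n -> finType) (E : forall v, rel (T v)).
Arguments E : clear implicits.
Hypothesis T_gt0 : forall v, 0 < #|T v|.
Variables (S : forall v, seq (T v)) (c : forall v, T v).
Arguments S : clear implicits.
Arguments c : clear implicits.
Hypothesis grundy_S : forall v, grundy_dom_seq (E v) (S v).

Lemma replace_SC_legal :
  legal_dom_seq (xjoin G E) (replace_seq I S c (SC m I)) /\
  size (replace_seq I S c (SC m I)) + #|I| * m.+1
    = \sum_(v in I) gamma_gr (E v) + n.
Proof.
have [l [-> leg_l sIl dom_l size_l]] := SC_ordinals.
pose blk v := if v \in I then [seq Tagged T a | a <- S v] else [:: Tagged T (c v)].
have -> : replace_seq I S c (map val l) = flatten (map blk l).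
  rewrite /replace_seq -map_comp; congr flatten; apply: eq_map => v /=.
  by rewrite valK.
have [legS domS sizeS] : [/\ forall v, legal_seq (E v) (S v),
    forall v b, exists2 a, a \in S v & b \in cnbh (E v) a
    & forall v, size (S v) = gamma_gr (E v)].
  by split=> v; have /andP[/legal_dom_seqP[leg dom] /eqP] := grundy_S v.
have tag_blk v z : z \in blk v -> tag z = v.
  by rewrite /blk; case: ifP => _; [case/mapP=> a _ -> | rewrite inE => /eqP->].
have mem_blk v z : v \in l -> z \in blk v -> z \in flatten (map blk l).
  by move=> vl zv; apply/flattenP; exists (blk v); rewrite ?map_f.
split.
  apply/legal_dom_seqP; split.
    move=> s1 z s2 def_s; have [l1 [k [l2 [t1 [t2 [def_l def_k ->]]]]]] := flatten_split def_s.
    have [w [kw l1w Iw]] := leg_l _ _ _ def_l.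
    have undom y : tag y = w -> forall u, u \in flatten (map blk l1) ->
        y \notin cnbh (xjoin G E) u.
      move=> tag_y u /flattenP[_ /mapP[v vl ->] /tag_blk tag_u].
      by apply: contra (l1w v vl) => /cnbh_xjoin_tag; rewrite tag_y tag_u.
    have [kI | kI] := boolP (k \in I).
      move: def_k; rewrite /blk kI => def_k.
      have [r1 [a [r2 [def_S def_z def_t2]]]] := map_split def_k.
      have def_t1 : t1 = [seq Tagged T b | b <- r1].
        have := congr1 (take (size r1)) def_k.
        have size_t1 : size t1 = size r1.
          have := congr1 size def_k.
          by rewrite def_S size_map !size_cat /= -def_t2 size_map; lia.
        by rewrite def_S map_cat !take_size_cat ?size_map // => <-.
      have [b ab r1b] := legS k _ _ _ def_S.
      exists (Tagged T b); first by rewrite -def_z cnbh_xjoin_same.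
      move=> u; rewrite mem_cat => /orP[|]; first by apply: undom; rewrite /= Iw.
      by rewrite def_t1 => /mapP[d dr ->]; rewrite cnbh_xjoin_same r1b.
    have t1_0 : t1 = [::] /\ z = Tagged T (c k).
      by move: def_k; rewrite /blk (negPf kI); case: (t1) => [|? [|]] //= [->].
    case: t1_0 => -> ->.
    (* If [k != w], any vertex of the non-empty factor of [w] is a footprint, as [k] and [w] are
       adjacent; if [k = w], the representative footprints itself. *)
    have [neq_kw | def_w] := eqVneq k w; last first.
      have /card_gt0P[b _] := T_gt0 w.
      exists (Tagged T b) => [|u]; last by rewrite cats0; apply: undom.
      by rewrite cnbh_xjoin_diff //=; move: kw; rewrite inE eq_sym (negPf def_w).
    exists (Tagged T (c k)); first exact: mem_cnbh.
    by move=> u; rewrite cats0; apply: undom.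
  case=> v b; have [vI | vI] := boolP (v \in I).
    have [a aS ab] := domS v b.
    exists (Tagged T a); last by rewrite cnbh_xjoin_same.
    by apply: (mem_blk v); [apply: sIl | rewrite /blk vI map_f].
  have [u ul Guv] := dom_l v vI.
  have [z zu] : exists z, z \in blk u.
    have /card_gt0P[d _] := T_gt0 u; have [a aS _] := domS u d.
    rewrite /blk; case: ifP => _; first by exists (Tagged T a); rewrite map_f.
    by exists (Tagged T (c u)); rewrite mem_head.
  exists z; first exact: mem_blk zu.
  have /andP[neq_uv _] := Guv.
  by rewrite cnbh_xjoin_diff /= (tag_blk _ _ zu).
have uniq_l : uniq l.
  apply: (@legal_seq_uniq _ G) => l1 k l2 def_l.
  by have [w [? ? _]] := leg_l l1 k l2 def_l; exists w.
(* The indicator stands on the left to avoid a subtraction: a member trades one vertex for a Grundy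
   sequence of its factor. *)
have size_blk v : size (blk v) + (v \in I) = (if v \in I then gamma_gr (E v) else 0) + 1.
  by rewrite /blk; case: ifP => _; rewrite ?size_map ?sizeS.
have sum_l (F : 'I_n -> nat) :
    \sum_(v <- l) (if v \in I then F v else 0) = \sum_(v in I) F v.
  rewrite big_uniq // -big_mkcondr; apply: eq_bigl => v.
  by rewrite andb_idl //; apply: sIl.
have card_l : \sum_(v <- l) (v \in I) = #|I|.
  by rewrite -sum1_card -sum_l; apply: eq_bigr => v _; case: ifP.
have := eq_bigr (fun v => _) (fun v (_ : true) => size_blk v) : 
  \sum_(v <- l) _ = _.
rewrite !big_split /= card_l sum_l sum1_size => sum_blk.
rewrite size_flatten /shape -map_comp sumnE big_map /=.
by rewrite mulnS addnA sum_blk -addnA size_l.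
Qed.

End LowerBound.

(** * Both bounds combined, over the integers *)

Import Order.TTheory GRing.Theory Num.Theory.
Local Open Scope ring_scope.

Theorem theorem2 (n m : nat) (T : 'I_n -> finType) (E : forall i, rel (T i)) :
  (0 < m)%N -> (2 * m.+1 <= n)%N ->
  (forall i, simple_graph (E i)) -> (forall i, (0 < #|T i|)%N) ->
  let X := xjoin (@cpow_adj n m) E in
  let f (I : {set 'I_n}) : int :=
    \sum_(i in I) (gamma_gr (E i))%:Z - (#|I| * m.+1)%:Z in
  ((forall I, I2 m I -> f I + n%:Z <= (gamma_gr X)%:Z) /\
   (exists2 I, I2 m I & (gamma_gr X)%:Z = f I + n%:Z)) /\
  (forall (S : forall i, seq (T i)) (c : forall i, T i) (Istar : {set 'I_n}),
     (forall i, grundy_dom_seq (E i) (S i)) ->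
     I2 m Istar -> (forall I, I2 m I -> f I <= f Istar) ->
     grundy_dom_seq X (replace_seq Istar S c (SC m Istar))).
Proof.
move=> m_gt0 n_large _ T_gt0 X f.
(* Adding [|I|(m+1)] back moves the comparison to natural numbers. *)
have f_nat I : f I + n%:Z + (#|I| * m.+1)%:Z = (\sum_(i in I) gamma_gr (E i) + n)%N%:Z.
  by rewrite /f addrAC subrK PoszD (big_morph Posz PoszD (erefl _)).
have lower S c I : (forall i, grundy_dom_seq (E i) (S i)) -> I2 m I ->
  legal_dom_seq X (replace_seq I S c (SC m I)) /\
    f I + n%:Z = (size (replace_seq I S c (SC m I)))%:Z.
  move=> grundy_S I2I.
  have [leg size_s] := replace_SC_legal m_gt0 I2I T_gt0 c grundy_S; split=> //.
  by apply: (addIr (#|I| * m.+1)%:Z); rewrite f_nat -size_s PoszD.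
have f_le I : I2 m I -> f I + n%:Z <= (gamma_gr X)%:Z.
  move=> I2I; pose S i := xchoose (gamma_gr_attained (E i)).
  have c i : T i by have /card_gt0P/sigW[] := T_gt0 i.
  have [|leg ->] := lower S c I _ I2I; first by move=> i; apply: xchooseP.
  by rewrite lez_nat; apply: legal_dom_seq_gamma.
have [I I2I le_f] := gamma_xjoin_le E n_large T_gt0.
(* The set [I] given by the upper bound is optimal, since [f_le] supplies the reverse inequality. *)
have def_gamma : (gamma_gr X)%:Z = f I + n%:Z.
  apply/eqP; rewrite eq_le f_le // andbT.
  by rewrite -(lerD2r (#|I| * m.+1)%:Z) f_nat -PoszD lez_nat.
split; first by split=> //; exists I.
move=> S c J grundy_S I2J maxJ; have [leg def_f] := lower S c J grundy_S I2J.
rewrite /grundy_dom_seq leg -eqz_nat -def_f eq_le f_le //= def_gamma.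
by rewrite lerD2r maxJ.
Qed.
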